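(* For every positive integer $n$, $\mathrm{ex}(n,C_3,\mathrm{rainbow}\text{-}C_5)\leq 32n^{3/2}$; that is, every $n$-vertex graph that admits a proper edge-coloring with no rainbow copy of the $5$-cycle $C_5$ contains at most $32n^{3/2}$ triangles.
   Context: $C_m$ denotes the cycle with $m$ edges; $C_3$ is a triangle. A proper edge-coloring assigns colors to edges so that edges sharing a vertex get distinct colors. A copy of a graph in an edge-colored graph is rainbow if all its edges receive distinct colors. For graphs $F,H$, $\mathrm{ex}(n,F,\mathrm{rainbow}\text{-}H)$ is the maximum number of copies of $F$ in an $n$-vertex graph that has a proper edge-coloring containing no rainbow copy of $H$. *)

(* Defs.v *)
From HB Require Import structures.
From mathcomp Require Import all_boot all_order all_algebra.
From mathcomp Require Import boolp reals exp.

Set Implicit Arguments.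
Unset Strict Implicit.
Unset Printing Implicit Defensive.

Record sgraph (V : finType) := SGraph {
  edges :> {set {set V}};
  edgesP : [forall e in edges, #|e| == 2]
}.

HB.instance Definition _ (V : finType) := [isSub for @edges V].
#[hnf] HB.instance Definition _ (V : finType) := [Finite of sgraph V by <:].

Definition cycle_edges (m : nat) : {set {set 'I_m}} :=
  [set [set i; ordS i] | i : 'I_m].

Lemma cycle_edgesP (m : nat) :
  2 < m -> [forall e in cycle_edges m, #|e| == 2].
Proof.
move=> m_gt2; apply/forall_inP => _ /imsetP[i _ ->].
rewrite cards2 -(inj_eq val_inj) /=.
suff /negP/negPf -> : ~ (i == i.+1 %% m :> nat) by [].
move=> /eqP i_eq; have [lt_i1m | le_m_i1] := ltnP i.+1 m.
  by move: i_eq; rewrite modn_small // => /n_Sn.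
have i1_eq : i.+1 = m by apply/eqP; rewrite eqn_leq le_m_i1 ltn_ord.
move: i_eq; rewrite i1_eq modnn => i0.
by move: m_gt2; rewrite -i1_eq i0.
Qed.

Definition cycle_graph (m : nat) (m_gt2 : 2 < m) : sgraph 'I_m :=
  SGraph (cycle_edgesP m_gt2).

Section Copies.
Variables (U V : finType) (F : sgraph U) (G : sgraph V).

(* A subgraph of G is given by its vertex set S.1 and its edge set S.2, and   *)
(* it is a copy of F when some injection U -> V carries F onto it. Distinct   *)
(* injections with the same image thus give a single copy.                    *)
Definition copies : {set {set V} * {set {set V}}} :=
  [set S : {set V} * {set {set V}} | (S.2 \subset edges G) &&
    [exists f : {ffun U -> V},
      [&& injectiveb f, [set f x | x : U] == S.1 &
          [set f @: (e : {set U}) | e in edges F] == S.2]]].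

End Copies.

(* Colorings are total functions, but only their values on edges matter;      *)
(* as graphs are finite, natural numbers provide enough colors.               *)
Definition proper_edge_coloring (V : finType) (G : sgraph V)
    (c : {set V} -> nat) : Prop :=
  forall e1 e2 : {set V}, e1 \in edges G -> e2 \in edges G ->
    e1 != e2 -> e1 :&: e2 != set0 -> c e1 != c e2.

Definition rainbow (V : finType) (c : {set V} -> nat)
    (S : {set V} * {set {set V}}) : Prop :=
  {in S.2 &, injective c}.

Definition rainbow_free_colorable (U V : finType) (H : sgraph U)
    (G : sgraph V) : Prop :=
  exists c : {set V} -> nat, proper_edge_coloring G c /\
    forall S, S \in copies H G -> ~ rainbow c S.

Definition ex_rainbow (n : nat) (U1 U2 : finType) (F : sgraph U1)
    (H : sgraph U2) : nat :=
  \max_(G : sgraph 'I_n | `[< rainbow_free_colorable H G >]) #|copies F G|.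

(* Main.v *)
(* Call an edge light if it lies in at least one and at most six triangles.
   An edge ab in more than six triangles lies on no 4-cycle abcd in which bc
   and da have different colors, since otherwise ab could be replaced by a path
   axb to give a rainbow 5-cycle; as two triangles abx, aby usually produce such
   a 4-cycle axby, every triangle has a light edge. So it suffices to bound the
   number D of ordered light pairs. For a light path uzw, replacing uz by uyz
   for a triangle uzy shows that u and w have at most six common light
   neighbors, except when w = y or zw has the color of uy, which happens for at
   most two w for each uz. Counting light paths of length two with the
   Cauchy-Schwarz inequality gives D^2 <= n (6 n^2 + 3 D). *)
Require Import Defs.
From mathcomp Require Import all_boot all_order all_algebra.
From mathcomp Require Import boolp reals exp.
From mathcomp Require Import zify.

(** * Selection and Cauchy-Schwarz tools *)

(** Each set in [s] rules out at most one element of [A]. This selects vertices that avoid finitely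
    many forbidden positions and colors. *)
Lemma avoid_small_sets (T : finType) (A : {set T}) (s : seq {set T}) :
  all (fun B : {set T} => #|B| <= 1) s -> size s < #|A| ->
  exists2 x, x \in A & all (fun B : {set T} => x \notin B) s.
Proof.
elim: s A => [|B s IHs] A /=.
  by move=> _ /card_gt0P[x xA]; exists x.
move=> /andP[B1 s1] sA.
have /(IHs _ s1)[x] : size s < #|A :\: B|.
  have := cardsID B A; have := subset_leq_card (subsetIr A B); lia.
by rewrite inE => /andP[xB xA] xs; exists x => //; rewrite xB.
Qed.

Lemma sqr_sum_leq (I : finType) (F : I -> nat) :
  (\sum_i F i) ^ 2 <= #|I| * \sum_i F i ^ 2.
Proof.
rewrite -(leq_pmul2l (isT : 0 < 2)) -mulnn.
have -> : 2 * ((\sum_i F i) * \sum_i F i) = \sum_i \sum_j 2 * (F i * F j).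
  rewrite big_distrl big_distrr /=; apply: eq_bigr => i _.
  by rewrite !big_distrr.
have -> : 2 * (#|I| * \sum_i F i ^ 2) = \sum_i \sum_j (F i ^ 2 + F j ^ 2).
  under [RHS]eq_bigr do rewrite big_split sum_nat_const.
  by rewrite big_split sum_nat_const -big_distrr /= addnn mul2n.
by apply: leq_sum => i _; apply: leq_sum => j _; apply: nat_Cauchy.
Qed.

(** * Proper colorings and pentagons *)

Section RainbowC5Free.
Variables (V : finType) (G : sgraph V) (c : {set V} -> nat).
Hypothesis c_proper : proper_edge_coloring G c.
Hypothesis c_free :
  forall S, S \in copies (@cycle_graph 5 isT) G -> ~ rainbow c S.

Definition adj (a b : V) := [set a; b] \in edges G.
Definition col (a b : V) := c [set a; b].

Lemma adjC a b : adj a b = adj b a.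
Proof. by rewrite /adj setUC. Qed.

Lemma colC a b : col a b = col b a.
Proof. by rewrite /col setUC. Qed.

Lemma adj_neq a b : adj a b -> a != b.
Proof.
by have /forall_inP/[apply] := edgesP G; rewrite cards2; case: (a =P b).
Qed.

Lemma col_neq a b d : adj a b -> adj a d -> b != d -> col a b != col a d.
Proof.
move=> ab ad bd; apply: c_proper => //.
  apply: contra bd => /eqP/setP/(_ b); rewrite !inE eqxx orbT.
  by have /negPf-> : b != a by rewrite eq_sym (adj_neq _ _ ab).
by apply/set0Pn; exists a; rewrite !inE eqxx.
Qed.

Lemma col_neq_path a b d : adj a b -> adj b d -> a != d -> col a b != col b d.
Proof. by rewrite adjC colC; apply: col_neq. Qed.

Definition colored_nbrs (a : V) (k : nat) := [set x | adj a x & col a x == k].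

Lemma card_colored_nbrs a k : #|colored_nbrs a k| <= 1.
Proof.
apply/card_le1_eqP => x y; rewrite !inE => /andP[ax /eqP xk] /andP[ay /eqP yk].
by apply: contra_eq xk => yx; rewrite -yk col_neq // eq_sym.
Qed.

(** Properness separates the colors of consecutive edges, so only the five pairs of disjoint edges
    appear as hypotheses. *)
Lemma no_rainbow_pentagon v0 v1 v2 v3 v4 :
  uniq [:: v0; v1; v2; v3; v4] ->
  adj v0 v1 -> adj v1 v2 -> adj v2 v3 -> adj v3 v4 -> adj v4 v0 ->
  col v0 v1 != col v2 v3 -> col v0 v1 != col v3 v4 ->
  col v1 v2 != col v3 v4 -> col v1 v2 != col v4 v0 ->
  col v2 v3 != col v4 v0 -> False.
Proof.
move=> Uv a01 a12 a23 a34 a40 c0123 c0134 c1234 c1240 c2340.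
pose vs := [:: v0; v1; v2; v3; v4].
pose f := [ffun i : 'I_5 => nth v0 vs i].
pose cs := [:: col v0 v1; col v1 v2; col v2 v3; col v3 v4; col v4 v0].
have Uc : uniq cs.
  move: Uv; rewrite /= !inE !negb_or !andbT.
  case/and4P => /and4P[_ n02 n03 _] /and3P[_ n13 n14] /andP[_ n24] _.
  have c0140 : col v0 v1 != col v4 v0.
    by rewrite eq_sym col_neq_path // eq_sym n14.
  rewrite c0123 c0134 c1234 c1240 c2340 c0140 !col_neq_path //=.
  by rewrite eq_sym n03.
have adjf i : adj (f i) (f (ordS i)).
  by rewrite !ffunE; case: i => -[|[|[|[|[|//]]]]] ?; [exact: a01 | exact: a12
    | exact: a23 | exact: a34 | exact: a40].
have colf i : col (f i) (f (ordS i)) = nth 0 cs i.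
  by rewrite !ffunE; case: i => -[|[|[|[|[|//]]]]].
have imf (i : 'I_5) : f @: [set i; ordS i] = [set f i; f (ordS i)].
  by rewrite imsetU1 imset_set1.
pose S := ([set f x | x : 'I_5],
  [set f @: (e : {set 'I_5}) | e in edges (@cycle_graph 5 isT)]).
apply: (c_free S).
  rewrite inE; apply/andP; split.
    apply/subsetP => _ /imsetP[_ /imsetP[i _ ->] ->]; rewrite imf.
    exact: adjf.
  apply/existsP; exists f; rewrite !eqxx !andbT; apply/injectiveP => i j.
  by rewrite !ffunE => /eqP; rewrite nth_uniq ?ltn_ord // => /eqP/val_inj.
move=> _ _ /imsetP[_ /imsetP[i _ ->] ->] /imsetP[_ /imsetP[j _ ->] ->].
rewrite !imf -!/(col _ _) !colf => /eqP.
by rewrite nth_uniq ?ltn_ord // => /eqP/val_inj->.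
Qed.

(** * Light edges in triangles *)

Definition common_nbrs (a b : V) := [set x | adj a x & adj b x].

Lemma common_nbrsC a b : common_nbrs a b = common_nbrs b a.
Proof. by apply/setP => x; rewrite !inE andbC. Qed.

(** Among seven common neighbors, some [x] would make [a x b d e] a rainbow pentagon. *)
Lemma card_common_nbrs_square a b d e :
  uniq [:: a; b; d; e] -> [&& adj a b, adj b d, adj d e & adj e a] ->
  col b d != col e a -> #|common_nbrs a b| <= 6.
Proof.
move=> U /and4P[ab bd de ea] bd_ea; rewrite leqNgt; apply/negP.
(* [x] must differ from [d] and [e], and each of [ax], [xb] must avoid the colors of the two
   pentagon edges disjoint from it. These six sets give the bound 6. *)
pose s := [:: [set d]; [set e]; colored_nbrs a (col b d);
  colored_nbrs a (col d e); colored_nbrs b (col d e); colored_nbrs b (col e a)].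
case/(avoid_small_sets _ _ s); first by rewrite /= !cards1 !card_colored_nbrs.
move=> x; rewrite !inE => /andP[ax bx].
rewrite /= !inE ax bx /= => /and5P[xd xe n1 n2 /and3P[n3 n4 _]].
apply: (no_rainbow_pentagon a x b d e) => //; rewrite 1?(adjC x) //; last 2 first.
- by rewrite (colC x).
- by rewrite (colC x).
- move: U; rewrite /= !inE !negb_or !andbT.
  case/and3P => /and3P[-> -> ->] /andP[-> ->] ->; rewrite xd xe (adj_neq a x) //.
  by rewrite eq_sym adj_neq.
Qed.

Definition light (a b : V) := adj a b && (0 < #|common_nbrs a b| <= 6).

Lemma lightC a b : light a b = light b a.
Proof. by rewrite /light adjC common_nbrsC. Qed.

Lemma light_adj a b : light a b -> adj a b.
Proof. by case/andP. Qed.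

(** If [ab] has more than six common neighbors, one of them, [y], differs from [x] and has [ay]
    colored unlike [xb]. The 4-cycle [a x b y] then shows that [ax] is light. *)
Lemma triangle_light a b x :
  adj a b -> adj b x -> adj x a -> light a b || light a x.
Proof.
move=> ab bx xa.
have xab : x \in common_nbrs a b by rewrite inE adjC xa.
have bax : b \in common_nbrs a x by rewrite inE ab adjC.
rewrite /light ab (adjC a x) xa !(introT card_gt0P) /=; [|by exists b|by exists x].
case: leqP => //= heavy_ab.
have [] := avoid_small_sets _ (common_nbrs a b)
  [:: [set x]; colored_nbrs a (col x b)].
- by rewrite /= cards1 card_colored_nbrs.
- exact: leq_trans heavy_ab.
move=> y; rewrite !inE /= !inE => /andP[ay yb] /and3P[yx].
rewrite ay /= => yxb _.
apply: (card_common_nbrs_square a x b y).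
- rewrite /= !inE !negb_or !andbT (eq_sym a x) (adj_neq x a) //.
  by rewrite (adj_neq a b) // (adj_neq a y) // (eq_sym x) adj_neq // eq_sym yx adj_neq.
- by rewrite (adjC a) xa (adjC x) bx yb adjC.
- by rewrite eq_sym (colC y).
Qed.

(** * Light paths of length two *)

Definition light_nbrs (a : V) := [set x | light a x].

(** Among seven common light neighbors, some [z'] would make [u y z w z'] a rainbow pentagon: [uy]
    and [zw] differ by hypothesis, and the six avoided sets handle distinctness and the other four
    disjoint pairs. *)
Lemma card_common_light_nbrs u w z y :
  u != w -> light u z -> light z w -> y \in common_nbrs u z -> y != w ->
  col u y != col z w -> #|light_nbrs u :&: light_nbrs w| <= 6.
Proof.
move=> uw /light_adj uz /light_adj zw; rewrite inE => /andP[uy zy] yw uy_zw.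
rewrite leqNgt; apply/negP.
pose s := [:: [set z]; [set y]; colored_nbrs w (col u y);
  colored_nbrs w (col y z); colored_nbrs u (col y z); colored_nbrs u (col z w)].
case/(avoid_small_sets _ _ s); first by rewrite /= !cards1 !card_colored_nbrs.
move=> z'; rewrite !inE => /andP[/light_adj uz' /light_adj wz'].
rewrite /= !inE uz' wz' /= => /and5P[z'z z'y n1 n2 /and3P[n3 n4 _]].
apply: (no_rainbow_pentagon u y z w z') => //; rewrite 1?adjC //.
- rewrite /= !inE !negb_or !andbT uw yw (eq_sym y z') z'y (eq_sym z z') z'z.
  by rewrite !adj_neq // adjC.
- by rewrite eq_sym.
- by rewrite eq_sym.
- by rewrite eq_sym (colC z').
- by rewrite eq_sym (colC z').
Qed.

(** The default [a] is never reached on light pairs, which lie in a triangle. *)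
Definition third_vertex (a b : V) := odflt a [pick x in common_nbrs a b].

Lemma third_vertexP a b : light a b -> third_vertex a b \in common_nbrs a b.
Proof.
case/and3P=> _ /card_gt0P[x x_ab] _; rewrite /third_vertex.
by case: pickP => [//|/(_ x)]; rewrite x_ab.
Qed.

(** The ends [w] of light paths [u z w] to which [card_common_light_nbrs] applies, with [y] the
    chosen third vertex. *)
Definition good_ends (u z : V) :=
  [set w in light_nbrs z | [&& u != w, third_vertex u z != w &
                              col u (third_vertex u z) != col z w]].

(** The 3 accounts for [u], [y] and the at most one [w] for which [zw] has the color of [uy]. *)
Lemma card_light_nbrs_leq u z :
  light u z -> #|light_nbrs z| <= 3 + #|good_ends u z|.
Proof.
move=> uz; set y := third_vertex u z.
have sub : light_nbrs z \subset
    [set u] :|: [set y] :|: colored_nbrs z (col u y) :|: good_ends u z.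
  apply/subsetP => w; rewrite !inE => zw; rewrite zw (light_adj _ _ zw) -/y /=.
  by rewrite !(eq_sym w) (eq_sym (col z w)); do 3!case: eqP.
apply: leq_trans (subset_leq_card sub) _.
apply: leq_trans (leq_card_setU _ _) _; rewrite leq_add2r.
apply: leq_trans (leq_card_setU _ _) _.
apply: (@leq_add _ _ 2 1); last exact: card_colored_nbrs.
by rewrite cards2; case: (_ != _).
Qed.

(** Exchanging the sums, each [w] is counted once per [z] with [w] a good end, and all such [z] are
    common light neighbors of [u] and [w]. *)
Lemma sum_good_ends_leq u :
  \sum_(z in light_nbrs u) #|good_ends u z| <= 6 * #|V|.
Proof.
under eq_bigr do rewrite -sum1_card.
rewrite (exchange_big_dep predT) //= mulnC -sum_nat_const.
apply: leq_sum => w _; rewrite sum1dep_card.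
(* A single such [z] already bounds the number of all of them by six. *)
have [->|[z]] := set_0Vmem
  [set z in light_nbrs u | w \in good_ends u z]; first by rewrite cards0.
rewrite !inE => /andP[uz /and4P[zw uw yw uy_zw]].
apply: leq_trans (card_common_light_nbrs u w z _ uw uz zw
  (third_vertexP _ _ uz) yw uy_zw).
apply/subset_leq_card/subsetP => z'; rewrite !inE.
by case/andP=> -> /andP[]; rewrite lightC.
Qed.

Lemma sum_sqr_light_degree_leq :
  \sum_z #|light_nbrs z| ^ 2 <=
    6 * #|V| ^ 2 + 3 * \sum_z #|light_nbrs z|.
Proof.
(* Light walks [u z w], with [u = w] allowed, are counted by middle vertex and by first edge. *)
have -> : \sum_z #|light_nbrs z| ^ 2 =
    \sum_u \sum_(z in light_nbrs u) #|light_nbrs z|.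
  rewrite [RHS](exchange_big_dep predT) //=; apply: eq_bigr => z _.
  rewrite sum_nat_const -mulnn; congr (_ * _); apply: eq_card => u.
  by rewrite inE lightC -[RHS]/(z \in light_nbrs u) inE.
apply: (@leq_trans (\sum_u (3 * #|light_nbrs u| + 6 * #|V|))); last first.
  by rewrite big_split /= -big_distrr /= sum_nat_const addnC mulnCA mulnn.
apply: leq_sum => u _; apply: leq_trans (leq_add (leqnn _) (sum_good_ends_leq u)).
rewrite mulnC -sum_nat_const -big_split /=.
by apply: leq_sum => z; rewrite inE => /card_light_nbrs_leq.
Qed.

(** Absorbing [6nD <= 9n^2 + D^2] into twice the bound [D_le] leaves [D^2 <= 12n^3 + 9n^2]. *)
Lemma sqr_sum_light_degree_leq :
  (\sum_z #|light_nbrs z|) ^ 2 <= 21 * #|V| ^ 3.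
Proof.
set D := \sum_z _; set n := #|V|.
have D_le : D ^ 2 <= n * (6 * n ^ 2 + 3 * D).
  apply: leq_trans (sqr_sum_leq _ _) _.
  by rewrite leq_mul2l sum_sqr_light_degree_leq orbT.
have amgm := (nat_Cauchy (3 * n) D).1.
have n2n3 : n ^ 2 <= n ^ 3 by case: n {D_le amgm} => // m; rewrite leq_pexp2l.
by rewrite !expnS !expn0 in D_le amgm n2n3 *; nia.
Qed.

(** * Counting triangles by light edges *)

Definition triangle_copy (t : V * V * V) : {set V} * {set {set V}} :=
  let: (a, b, x) := t in
  ([set a; b; x], [set [set a; b]; [set b; x]; [set x; a]]).

Lemma triangle_copy_rot a b x :
  triangle_copy (a, b, x) = triangle_copy (b, x, a).
Proof.
by congr pair; apply/setP => z; rewrite !inE -orbA orbC.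
Qed.

Lemma copies_triangleP S : S \in copies (@cycle_graph 3 isT) G ->
  exists a b x, [/\ adj a b, adj b x, adj x a & S = triangle_copy (a, b, x)].
Proof.
rewrite inE => /andP[/subsetP S_G /existsP[f /and3P[_ /eqP S1 /eqP S2]]].
pose i0 := @Ordinal 3 0 isT; pose i1 := @Ordinal 3 1 isT.
pose i2 := @Ordinal 3 2 isT.
have ord3 (i : 'I_3) : [|| i == i0, i == i1 | i == i2].
  by case: i => -[|[|[|]]].
have e0 : ordS i0 = i1 by apply: val_inj.
have e1 : ordS i1 = i2 by apply: val_inj.
have e2 : ordS i2 = i0 by apply: val_inj.
have imf (i : 'I_3) : f @: [set i; ordS i] = [set f i; f (ordS i)].
  by rewrite imsetU1 imset_set1.
have S2E i : [set f i; f (ordS i)] \in S.2.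
  by rewrite -S2 -imf; apply/imset_f/imset_f.
exists (f i0), (f i1), (f i2); split.
- by have := S_G _ (S2E i0); rewrite e0.
- by have := S_G _ (S2E i1); rewrite e1.
- by have := S_G _ (S2E i2); rewrite e2.
case: S S1 S2 S2E {S_G} => /= _ _ <- <- S2E; congr pair; apply/setP => z.
- rewrite !inE; apply/imsetP/orP => [[i _ ->]|].
    by case/or3P: (ord3 i) => /eqP->; rewrite eqxx ?orbT; auto.
  by case=> [/orP[]|] /eqP->; [exists i0|exists i1|exists i2].
- rewrite !inE; apply/idP/idP => [/imsetP[_ /imsetP[i _ ->] ->]|].
    rewrite imf; case/or3P: (ord3 i) => /eqP->; rewrite ?(e0, e1, e2) eqxx ?orbT //.
  have := S2E i2; have := S2E i1; have := S2E i0; rewrite e0 e1 e2 => h0 h1 h2.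
  by case/orP => [/orP[]|] /eqP->.
Qed.

(** Every triangle can be rotated so that its first edge is light, and an ordered light pair has at
    most six third vertices. *)
Lemma card_triangle_copies_leq :
  #|copies (@cycle_graph 3 isT) G| <= 6 * \sum_z #|light_nbrs z|.
Proof.
pose W := [set t : V * V * V | light t.1.1 t.1.2 & t.2 \in common_nbrs t.1.1 t.1.2].
have W_copies : copies (@cycle_graph 3 isT) G \subset triangle_copy @: W.
  apply/subsetP => _ /copies_triangleP[a [b [x [ab bx xa ->]]]].
  apply/imsetP; case/orP: (triangle_light _ _ _ ab bx xa) => L.
    by exists (a, b, x); rewrite // !inE /= L (adjC a) xa bx.
  exists (x, a, b); last by rewrite 2!triangle_copy_rot.
  by rewrite !inE /= lightC L (adjC x) bx ab.
apply: leq_trans (subset_leq_card W_copies) _.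
apply: leq_trans (leq_imset_card _ _) _.
rewrite -sum1_card.
have -> : \sum_(t in W) 1 =
    \sum_a \sum_(b in light_nbrs a) \sum_(x in common_nbrs a b) 1.
  rewrite [RHS]pair_big_dep pair_big_dep /=; apply: eq_bigl => -[[a b] x].
  by rewrite !inE.
rewrite big_distrr; apply: leq_sum => a _ /=; rewrite mulnC -sum_nat_const.
by apply: leq_sum => b; rewrite inE sum1_card => /and3P[].
Qed.

End RainbowC5Free.

(** * The bound over the reals *)

Import Order.TTheory GRing.Theory Num.Theory.
Local Open Scope ring_scope.

Theorem theorem2p1 (R : realType) (n : nat) (n_gt0 : (0 < n)%N) :
  (ex_rainbow n (@cycle_graph 3 isT) (@cycle_graph 5 isT))%:R
    <= 32 * (n%:R : R) `^ (3 / 2).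
Proof.
(* The squared bound stays within the naturals: [36 * 21 = 756 <= 1024 = 32^2]. *)
have sqr_le : (ex_rainbow n (@cycle_graph 3 isT) (@cycle_graph 5 isT) ^ 2 <=
    1024 * n ^ 3)%N.
  rewrite /ex_rainbow.
  elim/big_ind: _ => // [p q Hp Hq|G /asboolP[c [c_proper c_free]]].
    by case: (leqP p q).
  have D_le := sqr_sum_light_degree_leq _ _ _ c_proper c_free.
  have T_le := card_triangle_copies_leq _ _ _ c_proper c_free.
  rewrite card_ord in D_le; rewrite -leq_sqr expnMn in T_le.
  by apply: leq_trans T_le _; lia.
rewrite -ler_sqr ?nnegrE ?mulr_ge0 ?powR_ge0 // exprMn.
have -> : ((n%:R : R) `^ (3 / 2)) ^+ 2 = n%:R ^+ 3.
  by rewrite -powR_mulrn ?powR_ge0 // -powRrM divfK ?pnatr_eq0 // powR_mulrn.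
have := sqr_le; rewrite -(ler_nat R) natrM !natrX => /le_trans-> //.
by rewrite ler_pM2r ?exprn_gt0 ?ltr0n // -natrX ler_nat.
Qed.
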